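(* Let $S>0$ and let $x=(x_j)$, $y=(y_j)$ be nonincreasing summable sequences in $[0,1]$ with $\sum_jx_j\le S$ and $\sum_jy_j\le S$. For every $n\ge1$, $$\|x-y\|_\infty^2\le q_n(x,y)+\frac{4S}{\sqrt n}.$$ Consequently, for $0<\rho<2$, $C>0$ and $a,b\in\mathcal K_\rho(C)$, with $$H_n(a,b)=\min\Big\{1,\Big(q_n(a,b)+\frac{4S_\rho}{\sqrt n}\Big)^{1/4}\Big\},$$ one has $\|a-b\|_\infty\le C\,H_n(a,b)$. The bound is uniform in the rank and independent of spectral gaps and multiplicities.
   Context: For a nonincreasing summable sequence $x\subset[0,1]$ let $\mu_x=\sum_jx_j\delta_{x_j}$, $b_{k,n}(t)=\binom nkt^k(1-t)^{n-k}$, $\beta_{k,n}(x)=\int_0^1b_{k,n}\,d\mu_x$ for $0\le k\le n$, and $q_n(x,y)=\sum_{k=0}^n|\beta_{k,n}(x)-\beta_{k,n}(y)|$. $\mathcal K_\rho(C)=\{a_1\ge a_2\ge\cdots\ge0:\ a_j\le Cj^{-1/\rho}\ \forall j\}$. For $a,b\in\mathcal K_\rho(C)$, $q_n(a,b)$ means $q_n(x,y)$ with $x_j=(a_j/C)^2$, $y_j=(b_j/C)^2$; $S_\rho=2/(2-\rho)$ (so $\sum_jx_j\le S_\rho$). *)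

(* Defs.v *)
From HB Require Import structures.
From mathcomp Require Import all_boot all_order all_algebra.
From mathcomp Require Import all_classical all_reals all_analysis.

Set Implicit Arguments.
Unset Strict Implicit.
Unset Printing Implicit Defensive.

Import Order.TTheory GRing.Theory Num.Theory.
Import numFieldNormedType.Exports.

Local Open Scope classical_set_scope.
Local Open Scope ring_scope.

(* Sequences are indexed from 0: [x j] stands for the term x_{j+1}. *)

Definition unit_summable (R : realType) (x : R^nat) : Prop :=
  [/\ nonincreasing_seq x, forall j, 0 <= x j <= 1 & cvgn (series x)].

(* mu_x = sum_j x_j delta_{x_j}.  [mscale] takes its weight in {nonneg R},
   hence the absolute value, which is the identity when x >= 0; see
   [atomic_measureE]. *)
Definition atomic_measure (R : realType) (x : R^nat) :
    {measure set (measurableTypeR R) -> \bar R} :=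
  mseries (fun j =>
    mscale `|x j|%:nng (dirac (x j : measurableTypeR R))) 0.

Lemma atomic_measureE (R : realType) (x : R^nat)
    (A : set (measurableTypeR R)) : (forall j, 0 <= x j) ->
  atomic_measure x A =
  (\sum_(0 <= j <oo) (x j)%:E * dirac (x j : measurableTypeR R) A)%E.
Proof.
move=> x0; rewrite /atomic_measure /= /mseries.
apply: eq_eseriesr => j _ /=.
by rewrite /mscale /= ger0_norm.
Qed.

Definition bernstein (R : realType) (k n : nat) (t : R) : R :=
  'C(n, k)%:R * t ^+ k * (1 - t) ^+ (n - k).

Definition bernstein_moment (R : realType) (k n : nat) (x : R^nat) : R :=
  \int[atomic_measure x]_(t in `[0, 1]) bernstein k n t.

Definition q_dist (R : realType) (n : nat) (x y : R^nat) : R :=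
  \sum_(k < n.+1) `|bernstein_moment k n x - bernstein_moment k n y|.

(* [sup] is a junk value on unbounded sets, so this is the sup norm of u only
   when u is bounded. *)
Definition sup_norm (R : realType) (u : R^nat) : R :=
  sup (range (fun j => `|u j|)).

Definition decay_class (R : realType) (rho C : R) : set (R^nat) :=
  [set a | [/\ nonincreasing_seq a, forall j, 0 <= a j &
               forall j, a j <= C * j.+1%:R `^ (- rho^-1)]].

Definition rescale (R : realType) (C : R) (a : R^nat) : R^nat :=
  fun j => (a j / C) ^+ 2.

Definition S_rho (R : realType) (rho : R) : R := 2 / (2 - rho).

Definition H_bound (R : realType) (rho C : R) (n : nat) (a b : R^nat) : R :=
  Num.min 1 ((q_dist n (rescale C a) (rescale C b)
              + 4 * S_rho rho / Num.sqrt n%:R) `^ (4^-1)).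

(* Main.v *)
Require Import Defs.
From mathcomp Require Import all_boot all_order all_algebra.
From mathcomp Require Import all_classical all_reals all_analysis.
From mathcomp Require Import measurable_realfun lra.

Import Order.TTheory GRing.Theory Num.Theory.
Import numFieldNormedType.Exports.

Local Open Scope classical_set_scope.
Local Open Scope ring_scope.

(** The measure mu_x gives the point x_i the weight x_i, so a test function of
    the form f(t) = phi(t) / t integrates to sum_i phi(x_i).  When phi is a ramp
    from 0 to 1 this is a smoothed count of the terms of x above a level, and
    comparing such counts for x and y detects a gap at a given rank.

    Suppose that x_j - y_j = d > 0 (ranks counted from 0).  Let phi be 0 up to
    m = y_j + d/2 and 1 from m + d/2 = x_j on.  Monotonicity of the sequences
    gives sum_i phi(x_i) >= j + 1 and sum_i phi(y_i) <= j, whatever the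
    multiplicities, so the integrals of f against mu_x and mu_y differ by at
    least 1 ([rank_test_count_ge], [rank_test_count_le]).  Starting the ramp at
    the midpoint, and not at y_j, keeps it at distance at least d/2 from the
    pole of 1/t: hence f is Lipschitz with constant (d/2)^-2
    ([rank_test_lipschitz]), and |f| <= 1/d.

    A function with Lipschitz constant L is within L / (2 sqrt n) of its n-th
    Bernstein polynomial on [0, 1] ([bernstein_approx]), and the integral of
    that polynomial is the combination of the moments beta_{k,n} with
    coefficients f(k/n) ([bernstein_functional_cvg]).  Since both measures have
    mass at most S, this yields 1 <= q_n / d + 2 S (4 / d^2) / (2 sqrt n).
    Multiplying by d^2 and using d <= 1 gives d^2 <= q_n + 4 S / sqrt n
    ([sqr_gap_le_q_dist]).

    For the class K_rho(C), the rescaled squares (a_j / C)^2 are at most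
    j^(-2/rho) for j >= 1, whose sum is at most 1 plus the integral of
    t^(-2/rho) over [1, +oo), that is S_rho ([zeta_partial_sum_le]).  The fourth
    root then comes from (u - v)^2 <= |u^2 - v^2| for u, v >= 0
    ([dist_le_powR_quarter]). *)

(** * Bernstein polynomials *)

Lemma bernstein_ge0 {R : realType} k n (t : R) :
  0 <= t <= 1 -> 0 <= bernstein k n t.
Proof.
move=> /andP[t0 t1].
by rewrite /bernstein !mulr_ge0 ?exprn_ge0 ?subr_ge0.
Qed.

(** Pascal's rule, read as conditioning the binomial law on one trial.  Moments
    of the binomial law then follow by induction on n, for all g at once. *)
Lemma sum_bernsteinS {R : realType} n (g : nat -> R) (t : R) :
  \sum_(k < n.+2) g k * bernstein k n.+1 t =
  (1 - t) * (\sum_(k < n.+1) g k * bernstein k n t) +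
  t * (\sum_(k < n.+1) g k.+1 * bernstein k n t).
Proof.
have pascal (k : nat) : (k <= n)%N -> bernstein k.+1 n.+1 t =
    (1 - t) * bernstein k.+1 n t + t * bernstein k n t.
  move=> kn; rewrite /bernstein binS natrD subSS exprS.
  move: kn; rewrite leq_eqVlt => /predU1P[->|kn].
    by rewrite bin_small // binn; lra.
  have -> : (n - k)%N = (n - k.+1).+1 by rewrite subnS prednK // subn_gt0.
  by rewrite exprS; lra.
rewrite big_ord_recl /= (eq_bigr (fun k : 'I_n.+1 =>
  (1 - t) * (g k.+1 * bernstein k.+1 n t) + t * (g k.+1 * bernstein k n t)));
  last first.
  by move=> k _; rewrite /bump add1n pascal; [lra|rewrite -ltnS].
rewrite big_split /= -!mulr_sumr addrA; congr (_ + _).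
rewrite [in LHS]big_ord_recr [in RHS]big_ord_recl /=.
rewrite {3}/bernstein bin_small // !mul0r mulr0 addr0 mulrDr.
congr (_ + _); rewrite /bernstein !bin0 !subn0 !expr0 exprS; lra.
Qed.

Lemma sum_bernstein {R : realType} n (t : R) :
  \sum_(k < n.+1) bernstein k n t = 1.
Proof.
elim: n => [|n IH].
  by rewrite big_ord_recl big_ord0 /bernstein !mulr1 addr0.
have := sum_bernsteinS n (fun=> 1) t.
under eq_bigr do rewrite mul1r.
under [in RHS]eq_bigr do rewrite mul1r.
by move=> ->; rewrite IH; lra.
Qed.

(** The centre a is arbitrary because the induction step shifts it by 1; the
    variance is the case a = n t. *)
Lemma bernstein_second_moment {R : realType} n (a t : R) :
  \sum_(k < n.+1) (k%:R - a) ^+ 2 * bernstein k n t =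
  n%:R * t * (1 - t) + (n%:R * t - a) ^+ 2.
Proof.
elim: n a => [|n IH] a.
  by rewrite big_ord_recl big_ord0 /bernstein bin0 subn0 /= !expr0; lra.
rewrite (sum_bernsteinS n (fun k => (k%:R - a) ^+ 2)) IH.
under eq_bigr => k _.
  rewrite (_ : k.+1%:R - a = k%:R - (a - 1)); last by rewrite -natr1; lra.
  over.
by rewrite IH -natr1; lra.
Qed.

(** The error is at most L times the mean distance of k/n to t, which the
    variance t (1 - t) / n <= 1 / (4 n) controls.  In place of the
    Cauchy-Schwarz inequality, each distance d is bounded by
    sqrt n d^2 + 1 / (4 sqrt n), an instance of 2 u v <= u^2 + v^2 that loses
    nothing in the constant. *)
Lemma bernstein_approx {R : realType} n (f : R -> R) (L t : R) :
  (0 < n)%N -> 0 <= L ->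
  (forall s t, `|f s - f t| <= L * `|s - t|) -> 0 <= t <= 1 ->
  `|\sum_(k < n.+1) f (k%:R / n%:R) * bernstein k n t - f t|
    <= L / (2 * Num.sqrt n%:R).
Proof.
move=> n0 L0 fL t01; have n0' : 0 < n%:R :> R by rewrite ltr0n.
set r := Num.sqrt n%:R; have r0 : 0 < r by rewrite sqrtr_gt0.
have r2 : r ^+ 2 = n%:R by rewrite sqr_sqrtr // ltW.
set w := r^-1; have w0 : 0 < w by rewrite invr_gt0.
have rw : r * w = 1 by rewrite divff ?gt_eqF.
rewrite (_ : f t = \sum_(k < n.+1) f t * bernstein k n t); last first.
  by rewrite -mulr_sumr sum_bernstein mulr1.
rewrite -sumrB.
apply: (le_trans (ler_norm_sum _ _ _)).
have bound (k : 'I_n.+1) :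
    `|f (k%:R / n%:R) * bernstein k n t - f t * bernstein k n t| <=
    L * (w ^+ 3 * ((k%:R - n%:R * t) ^+ 2 * bernstein k n t)
         + w / 4 * bernstein k n t).
  rewrite -mulrBl normrM (ger0_norm (bernstein_ge0 _ _ _ t01)).
  rewrite [leRHS](_ : _ = L * (w ^+ 3 * (k%:R - n%:R * t) ^+ 2
    + w / 4) * bernstein k n t); last by lra.
  apply: ler_wpM2r; first exact: bernstein_ge0.
  apply: (le_trans (fL _ _)); apply: ler_wpM2l => //.
  set d := `|_ - t|.
  have -> : w ^+ 3 * (k%:R - n%:R * t) ^+ 2 = r * d ^+ 2.
    rewrite real_normK ?num_real // -r2 -exprVn -/w.
    have -> : k%:R * w ^+ 2 - t = w ^+ 2 * (k%:R - r ^+ 2 * t).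
      by rewrite mulrBr [w ^+ 2 * (_ * t)]mulrA -exprMn [w * r]mulrC rw expr1n
         mul1r mulrC.
    set X := k%:R - _.
    by rewrite -[w ^+ 3]mul1r -rw; lra.
  (* with r w = 1 supplied for the monomials at hand, what remains is linear *)
  have : 0 <= r * (d - w / 2) ^+ 2 by rewrite mulr_ge0 ?sqr_ge0 ?ltW.
  have : r * w * d = d by rewrite rw mul1r.
  have : r * w * w = w by rewrite rw mul1r.
  lra.
apply: le_trans; first by apply: ler_sum => k _; exact: bound.
rewrite -mulr_sumr; apply: ler_wpM2l => //.
rewrite big_split /= -!mulr_sumr bernstein_second_moment sum_bernstein.
rewrite subrr expr0n addr0 mulr1 -r2 invfM -/w.
have : 0 <= w * (1 - 2 * t) ^+ 2 by rewrite mulr_ge0 ?sqr_ge0 ?ltW.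
have : r * w * (r * w) * w * t * (1 - t) = w * t * (1 - t) by rewrite rw !mul1r.
lra.
Qed.

(** * The rank-counting test function *)

(** This is phi(t) / t for the ramp phi that is 0 on t <= m, (t - m) / h between
    m and m + h, and 1 from m + h on: the two arguments of the minimum are
    the branches (t - m) / (h t) and 1 / t, and replacing t by the maximum of t
    and m makes the first one vanish below m. *)
Definition rank_test {R : realType} (m h t : R) : R :=
  Num.min ((1 - m / Num.max t m) / h) (Num.max t m)^-1.

Lemma rank_test_ge0 {R : realType} (m h t : R) : 0 < m -> 0 < h ->
  0 <= rank_test m h t.
Proof.
move=> m0 h0; have u0 : 0 < Num.max t m by rewrite lt_max m0 orbT.
rewrite /rank_test le_min invr_ge0 (ltW u0) andbT divr_ge0 ?(ltW h0) //.
by rewrite subr_ge0 ler_pdivrMr // mul1r le_max lexx orbT.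
Qed.

Lemma rank_test_eq0 {R : realType} (m h t : R) :
  0 < m -> t <= m -> rank_test m h t = 0.
Proof.
move=> m0 tm; rewrite /rank_test max_r // divff ?gt_eqF // subrr mul0r min_l //.
by rewrite invr_ge0 ltW.
Qed.

Lemma mul_rank_test_le1 {R : realType} (m h t : R) :
  0 < m -> 0 <= t -> t * rank_test m h t <= 1.
Proof.
move=> m0 t0; apply: (@le_trans _ _ (t * (Num.max t m)^-1)).
  by apply: ler_wpM2l => //; rewrite /rank_test ge_min lexx orbT.
by rewrite ler_pdivrMr ?mul1r ?le_max ?lexx // lt_max m0 orbT.
Qed.

Lemma mul_rank_test_eq1 {R : realType} (m h t : R) :
  0 < m -> 0 < h -> m + h <= t -> t * rank_test m h t = 1.
Proof.
move=> m0 h0 tmh; have tm : m <= t by lra.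
have t0 : 0 < t by lra.
rewrite /rank_test max_l // min_r ?divff ?gt_eqF //.
rewrite ler_pdivlMr // lerBrDr [_ * h]mulrC -mulrDl ler_pdivrMr //.
by rewrite mul1r addrC.
Qed.

(** For u = max(t, m), the branch 1/u decreases in u and the branch
    (1 - m/u)/h increases; they cross at u = m + h, where the maximum is. *)
Lemma rank_test_le {R : realType} (m h t : R) :
  0 < m -> 0 < h -> rank_test m h t <= (m + h)^-1.
Proof.
move=> m0 h0; set u := Num.max t m.
have u0 : 0 < u by rewrite lt_max m0 orbT.
have mh0 : 0 < m + h by lra.
rewrite /rank_test -/u; have [umh|umh] := leP (m + h) u.
  by rewrite ge_min lef_pV2 ?posrE // umh orbT.
rewrite ge_min; apply/orP; left.
rewrite ler_pdivrMr //; set w := (m + h)^-1.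
have : w * (m + h) = 1 by rewrite mulVf ?gt_eqF.
have : m * w <= m * u^-1 by rewrite ler_pM2l // lef_pV2 ?posrE // ltW.
lra.
Qed.

(** Both branches are Lipschitz functions of 1 / max(t, m), which has constant
    m^-2; the factor m / h of the first branch gives 1 / (m h), and h <= m
    bounds both constants by h^-2. *)
Lemma rank_test_lipschitz {R : realType} (m h s t : R) : 0 < h -> h <= m ->
  `|rank_test m h s - rank_test m h t| <= h ^- 2 * `|s - t|.
Proof.
move=> h0 hm; have m0 : 0 < m := lt_le_trans h0 hm.
set u := Num.max s m; set v := Num.max t m.
have u0 : 0 < u by rewrite lt_max m0 orbT.
have v0 : 0 < v by rewrite lt_max m0 orbT.
have um : m <= u by rewrite /u le_max lexx orbT.
have vm : m <= v by rewrite /v le_max lexx orbT.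
have uv : `|u - v| <= `|s - t|.
  rewrite /u /v ler_norml.
  have [? ?] : s - t <= `|s - t| /\ t - s <= `|s - t|.
    by split; [exact: ler_norm|rewrite distrC; exact: ler_norm].
  by have [?|?] := leP s m; have [?|?] := leP t m; lra.
have inv_lip : `|u^-1 - v^-1| <= (m ^+ 2)^-1 * `|u - v|.
  rewrite (_ : u^-1 - v^-1 = (v - u) / (u * v)); last first.
    rewrite invfM mulrBl mulrCA mulfV ?gt_eqF // mulr1.
    by rewrite mulrA mulfV ?gt_eqF // mul1r.
  rewrite normrM distrC mulrC normfV (gtr0_norm (mulr_gt0 u0 v0)).
  apply: ler_wpM2r => //; rewrite lef_pV2 ?posrE ?mulr_gt0 ?exprn_gt0 //.
  by rewrite expr2 ler_pM // ltW.
have lip2 : `|u^-1 - v^-1| <= h ^- 2 * `|s - t|.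
  apply: (le_trans inv_lip); apply: ler_pM => //.
    by rewrite invr_ge0 exprn_ge0 // ltW.
  by rewrite lef_pV2 ?posrE ?exprn_gt0 // ler_pXn2r // nnegrE ltW.
have lip1 : `|(1 - m / u) / h - (1 - m / v) / h| <= h ^- 2 * `|s - t|.
  rewrite (_ : _ - _ = - (m / h * (u^-1 - v^-1))); last by lra.
  rewrite normrN normrM gtr0_norm ?divr_gt0 //.
  apply: (@le_trans _ _ (m / h * ((m ^+ 2)^-1 * `|u - v|))).
    by apply: ler_wpM2l => //; rewrite divr_ge0 // ltW.
  rewrite mulrA (_ : m / h * _ = (m * h)^-1); last first.
    by rewrite expr2 !invfM mulrAC mulrA mulfV ?gt_eqF // mul1r.
  apply: ler_pM => //; first by rewrite invr_ge0 mulr_ge0 // ltW.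
  rewrite lef_pV2 ?posrE ?exprn_gt0 ?mulr_gt0 // expr2.
  by rewrite ler_wpM2r // ltW.
rewrite /rank_test -/u -/v; move: lip1 lip2.
set a := _ / h; set b := _ / h; set K := h ^- 2 * _.
rewrite !ler_norml => /andP[? ?] /andP[? ?].
by have [?|?] := leP a u^-1; have [?|?] := leP b v^-1; lra.
Qed.

(** * Bernstein moments as series *)

Lemma bernstein_le1 {R : realType} k n (t : R) : (k <= n)%N ->
  0 <= t <= 1 -> bernstein k n t <= 1.
Proof.
move=> kn t01; rewrite -(sum_bernstein n t).
rewrite (bigD1 (Ordinal (kn : k < n.+1)%N)) //= lerDl.
by apply: sumr_ge0 => i _; exact: bernstein_ge0.
Qed.

Lemma bernstein_moment_cvg {R : realType} k n (x : R^nat) : (k <= n)%N ->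
  unit_summable x ->
  series (fun j => x j * bernstein k n (x j)) @ \oo -->
    bernstein_moment k n x.
Proof.
move=> kn [_ x01 xcvg].
have x0 j : 0 <= x j by have /andP[] := x01 j.
have cv : cvgn (series (fun j => x j * bernstein k n (x j))).
  apply: series_le_cvg xcvg => // j; first by rewrite mulr_ge0 ?bernstein_ge0.
  by rewrite ler_piMr // bernstein_le1.
suff -> : bernstein_moment k n x =
    limn (series (fun j => x j * bernstein k n (x j))) by [].
have mb : measurable_fun `[0 : R, 1] (@bernstein R k n).
  apply: measurable_funM.
    apply: measurable_funM => //; exact: exprn_measurable.
  by apply: measurable_funX; apply: measurable_funB.
have b0 (t : measurableTypeR R) : `[0, 1]%classic t ->
    (0 <= (bernstein k n (t : R))%:E)%E.
  by rewrite /= in_itv /= lee_fin => ?; exact: bernstein_ge0.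
rewrite /bernstein_moment /Rintegral /atomic_measure.
rewrite ge0_integral_measure_series //; last exact/measurable_EFinP.
rewrite (@eq_eseriesr _ _
  (fun j => (x j * bernstein k n (x j))%:E)); last first.
  move=> j _;  rewrite ge0_integral_mscale //; last exact/measurable_EFinP.
  rewrite integral_dirac //=; last exact/measurable_EFinP.
  rewrite diracE mem_set.
    by rewrite mul1e ger0_norm.
  by rewrite /= in_itv /= x01.
rewrite (_ : (fun _ => _) =
    EFin \o series (fun j => x j * bernstein k n (x j))); last first.
  by apply/funext => N /=; rewrite sumEFin.
by rewrite EFin_lim.
Qed.

(** Both sides are the integral against mu_x of the polynomial with Bernstein
    coefficients g. *)
Lemma bernstein_functional_cvg {R : realType} n (g : nat -> R) (x : R^nat) :
  unit_summable x ->
  series (fun j => x j * \sum_(k < n.+1) g k * bernstein k n (x j)) @ \oo -->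
    \sum_(k < n.+1) g k * bernstein_moment k n x.
Proof.
move=> xs; rewrite (_ : series _ = fun N => \sum_(k < n.+1)
    g k * series (fun j => x j * bernstein k n (x j)) N).
  apply: cvg_big => [|k _]; first exact: add_continuous.
  by apply: cvgMr; apply: bernstein_moment_cvg => //; rewrite -ltnS.
apply/funext => N; rewrite /series /=.
under [RHS]eq_bigr do rewrite mulr_sumr.
rewrite exchange_big /=; apply: eq_bigr => j _.
by rewrite mulr_sumr; apply: eq_bigr => k _; rewrite mulrCA.
Qed.

Lemma series_le_lim {R : realType} (x : R^nat) N :
  unit_summable x -> series x N <= limn (series x).
Proof.
move=> [_ x01 xcvg]; apply: nondecreasing_cvgn_le => //.
by apply/nondecreasing_series => i _ _; have /andP[] := x01 i.
Qed.

(** Working with partial sums, uniformly in their length, avoids the convergence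
    of the series attached to f itself. *)
Lemma bernstein_partial_sum {R : realType} n (f : R -> R) (L S : R)
    (x : R^nat) N :
  (0 < n)%N -> 0 <= L -> (forall s t, `|f s - f t| <= L * `|s - t|) ->
  unit_summable x -> limn (series x) <= S ->
  `|series (fun j => x j * \sum_(k < n.+1) f (k%:R / n%:R) *
                            bernstein k n (x j)) N
    - series (fun j => x j * f (x j)) N| <= S * (L / (2 * Num.sqrt n%:R)).
Proof.
move=> n0 L0 fL xs xS; have [_ x01 _] := xs.
rewrite /series /= -sumrB; apply: (le_trans (ler_norm_sum _ _ _)).
apply: (@le_trans _ _ (series x N * (L / (2 * Num.sqrt n%:R)))).
  rewrite /series /= mulr_suml; apply: ler_sum => j _.
  have /andP[xj0 _] := x01 j.
  rewrite -mulrBr normrM ger0_norm //; apply: ler_wpM2l => //.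
  exact: bernstein_approx.
apply: ler_wpM2r; first by rewrite divr_ge0 // mulr_ge0.
exact: le_trans (series_le_lim _ N xs) xS.
Qed.

(** * Comparing ranks *)

Lemma rank_test_count_ge {R : realType} (m h : R) (x : R^nat) (j N : nat) :
  0 < m -> 0 < h -> unit_summable x -> m + h <= x j -> (j < N)%N ->
  j.+1%:R <= series (fun i => x i * rank_test m h (x i)) N.
Proof.
move=> m0 h0 [xd x01 _] xj jN; rewrite /series /= (big_cat_nat _ jN) //=.
rewrite (@eq_big_nat _ _ _ _ _ _ (fun=> 1)).
  rewrite sumr_const_nat subn0 lerDl; apply: sumr_ge0 => i _.
  by rewrite mulr_ge0 ?rank_test_ge0 //; have /andP[] := x01 i.
move=> i /andP[_ ij]; apply: mul_rank_test_eq1 => //.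
by apply: le_trans xj _; exact: xd.
Qed.

Lemma rank_test_count_le {R : realType} (m h : R) (x : R^nat) (j N : nat) :
  0 < m -> unit_summable x -> x j <= m -> (j < N)%N ->
  series (fun i => x i * rank_test m h (x i)) N <= j%:R.
Proof.
move=> m0 [xd x01 _] xj jN; rewrite /series /= (big_cat_nat _ (ltnW jN)) //=.
rewrite [X in _ + X]big_nat_cond [X in _ + X]big1 ?addr0; last first.
  move=> i /andP[/andP[ji _] _]; rewrite rank_test_eq0 ?mulr0 //.
  by apply: le_trans xj; exact: xd.
apply: (@le_trans _ _ (\sum_(0 <= i < j) 1)); last first.
  by rewrite sumr_const_nat subn0.
apply: ler_sum => i _; apply: mul_rank_test_le1 => //.
by have /andP[] := x01 i.
Qed.

(** The test function has its ramp on the upper half [m, m + h] of the gap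
    [y_j, x_j], with h half the gap. *)
Lemma sqr_gap_le_q_dist {R : realType} (S : R) (x y : R^nat) n j :
  (0 < n)%N -> unit_summable x -> unit_summable y ->
  limn (series x) <= S -> limn (series y) <= S -> y j < x j ->
  (x j - y j) ^+ 2 <= q_dist n x y + 4 * S / Num.sqrt n%:R.
Proof.
move=> n0 xs ys xS yS yx.
have [_ x01 _] := xs; have [_ y01 _] := ys.
have /andP[xj0 xj1] := x01 j; have /andP[yj0 yj1] := y01 j.
pose d := x j - y j; pose h := d / 2; pose m := y j + h.
have d0 : 0 < d by rewrite subr_gt0.
have h0 : 0 < h by rewrite divr_gt0.
have hm : h <= m by rewrite lerDr.
have m0 : 0 < m by exact: lt_le_trans hm.
have mh : m + h = x j by rewrite /m /h /d; lra.
pose g k := rank_test m h (k%:R / n%:R).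
pose eps : R := S * (h ^- 2 / (2 * Num.sqrt n%:R)).
have L0 : 0 <= h ^- 2 by rewrite invr_ge0 exprn_ge0 // ltW.
have fL s t := @rank_test_lipschitz R m h s t h0 hm.
have lower : j.+1%:R - eps <= \sum_(k < n.+1) g k * bernstein_moment k n x.
  apply: (cvgr_to_ge (bernstein_functional_cvg n g _ xs)).
  exists j.+1 => // N /= jN.
  have := bernstein_partial_sum n _ _ _ _ N n0 L0 fL xs xS.
  have : j.+1%:R <= series (fun i => x i * rank_test m h (x i)) N.
    by apply: (@rank_test_count_ge R m h x j N); rewrite ?mh.
  rewrite ler_norml -/eps; lra.
have upper : \sum_(k < n.+1) g k * bernstein_moment k n y <= j%:R + eps.
  apply: (cvgr_to_le (bernstein_functional_cvg n g _ ys)).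
  exists j.+1 => // N /= jN.
  have := bernstein_partial_sum n _ _ _ _ N n0 L0 fL ys yS.
  have : series (fun i => y i * rank_test m h (y i)) N <= j%:R.
    by apply: (@rank_test_count_le R m h y j N); rewrite ?lerDl ?ltW.
  rewrite ler_norml -/eps; lra.
have diff : \sum_(k < n.+1) g k * bernstein_moment k n x -
    \sum_(k < n.+1) g k * bernstein_moment k n y <= d^-1 * q_dist n x y.
  rewrite -sumrB /q_dist mulr_sumr; apply: ler_sum => k _.
  rewrite -mulrBr; apply: (le_trans (ler_norm _)); rewrite normrM.
  apply: ler_wpM2r => //; rewrite ger0_norm ?rank_test_ge0 //.
  apply: (le_trans (rank_test_le _ _ _ m0 h0)).
  have dx : d <= x j by rewrite gerBl.
  by rewrite mh lef_pV2 ?posrE // (lt_le_trans d0).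
have q0 : 0 <= q_dist n x y by apply: sumr_ge0.
(* an integer rank gap of 1 survives the two approximation errors *)
have one : 1 - 2 * eps <= d^-1 * q_dist n x y.
  by move: lower; rewrite -natr1; lra.
have d1 : d <= 1 by rewrite /d; lra.
have dq : d ^+ 2 * (d^-1 * q_dist n x y) <= q_dist n x y.
  by rewrite expr2 mulrA mulfK ?gt_eqF // ler_piMl.
have deps : d ^+ 2 * (2 * eps) = 4 * S / Num.sqrt n%:R.
  have -> : d ^+ 2 = 4 * h ^+ 2 by rewrite /h; lra.
  rewrite /eps [(2 * _)^-1]invfM.
  have : h ^+ 2 * h ^- 2 = 1 by rewrite mulfV // expf_neq0 ?gt_eqF.
  set a := h ^+ 2; set b := h ^- 2; set c := (Num.sqrt _)^-1.
  move=> ab; transitivity (4 * S * c * (a * b)); first by lra.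
  by rewrite ab mulr1.
have := ler_wpM2l (sqr_ge0 d) one.
by rewrite mulrBr mulr1 deps -/d; lra.
Qed.

Lemma q_distC {R : realType} n (x y : R^nat) : q_dist n x y = q_dist n y x.
Proof. by apply: eq_bigr => k _; rewrite distrC. Qed.

Lemma sqr_dist_le_q_dist {R : realType} (S : R) (x y : R^nat) n j :
  (0 < n)%N -> unit_summable x -> unit_summable y ->
  limn (series x) <= S -> limn (series y) <= S ->
  `|x j - y j| ^+ 2 <= q_dist n x y + 4 * S / Num.sqrt n%:R.
Proof.
move=> n0 xs ys xS yS; rewrite real_normK ?num_real //.
have [yx|xy|->] := ltgtP (y j) (x j).
- exact: sqr_gap_le_q_dist.
- by rewrite -sqrrN opprB q_distC; exact: sqr_gap_le_q_dist.
rewrite subrr expr0n /= addr_ge0 ?sumr_ge0 // divr_ge0 ?mulr_ge0 //.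
apply: le_trans xS; apply: le_trans (series_le_lim _ 0 xs).
by rewrite /series /= big_geq.
Qed.

Lemma sup_norm_le {R : realType} (u : R^nat) (M : R) :
  (forall j, `|u j| <= M) -> sup_norm u <= M.
Proof.
by move=> uM; apply: ge_sup => [|_ [j _ <-]//]; exists `|u 0%N|, 0%N.
Qed.

(** * Power sums and the decay class *)

(** The right-hand side is the integral of t^(-(1+r)) over [k+1, k+2].  With
    M = k + 2 the claim reads 1 + r/M <= (M / (M - 1))^r, which follows from
    exp u >= 1 + u and ln (1 - 1/M) <= - 1/M. *)
Lemma powR_telescope {R : realType} (r : R) (k : nat) : 0 < r ->
  k.+2%:R `^ (- (1 + r)) <= (k.+1%:R `^ (- r) - k.+2%:R `^ (- r)) / r :> R.
Proof.
move=> r0; set M : R := k.+2%:R.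
have M0 : 0 < M by rewrite ltr0n.
have k0 : 0 < k.+1%:R :> R by rewrite ltr0n.
have lnM1 : M^-1 <= ln M - ln k.+1%:R.
  rewrite -lerN2 opprB -ln_div ?posrE //.
  rewrite (_ : k.+1%:R / M = 1 + - M^-1).
    by apply: le_ln1Dx; rewrite ltrN2 invf_lt1 // ltr1n.
  have : (k.+1%:R + 1) * M^-1 = 1 by rewrite natr1 divff ?gt_eqF.
  by move=> e; rewrite -[X in _ = X - _]e mulrDl mul1r addrK.
rewrite ler_pdivlMr // lerBrDr.
have -> : M `^ (- (1 + r)) = M `^ (- r) * M^-1.
  by rewrite opprD addrC powRD ?(gt_eqF M0) ?implybT // powR_inv1 // ltW.
have -> : k.+1%:R `^ (- r) = M `^ (- r) * expR (r * (ln M - ln k.+1%:R)) :> R.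
  by rewrite /powR !gt_eqF // -expRD; congr expR; lra.
rewrite -[X in _ + X]mulr1 -mulrA -mulrDr.
apply: ler_wpM2l; first exact: powR_ge0.
apply: le_trans (expR_ge1Dx _); rewrite addrC lerD2l mulrC.
by apply: ler_wpM2l => //; exact: ltW.
Qed.

Lemma zeta_partial_sum_le {R : realType} (p : R) N : 1 < p ->
  \sum_(0 <= j < N) j.+1%:R `^ (- p) <= p / (p - 1).
Proof.
move=> p1; have r0 : 0 < p - 1 by rewrite subr_gt0.
have pe : p / (p - 1) = 1 + (p - 1)^-1.
  by have := divff (lt0r_neq0 r0); lra.
case: N => [|N]; first by rewrite big_geq // divr_ge0 ?ltW //; lra.
(* strengthened by the tail integral, so that the induction telescopes *)
apply: (@le_trans _ _ (p / (p - 1) - N.+1%:R `^ (- (p - 1)) / (p - 1))).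
  elim: N => [|N IH]; first by rewrite big_nat1 !powR1 pe; lra.
  rewrite big_nat_recr //=; apply: (le_trans (lerD IH (lexx _))).
  have := powR_telescope _ N r0; rewrite [1 + (p - 1)](addrC) subrK; lra.
by rewrite gerBl divr_ge0 ?powR_ge0 // ltW.
Qed.

Lemma rescale_decay_class {R : realType} (rho C : R) (a : R^nat) :
  0 < rho -> rho < 2 -> 0 < C -> decay_class rho C a ->
  [/\ forall j, 0 <= a j / C <= 1, unit_summable (rescale C a) &
      limn (series (rescale C a)) <= S_rho rho].
Proof.
move=> rho0 rho2 C0 [ad a0 aC].
have u0 j : 0 <= a j / C by rewrite divr_ge0 // ltW.
have uC j : a j / C <= j.+1%:R `^ (- rho^-1) by rewrite ler_pdivrMr // mulrC.
have u1 j : a j / C <= 1.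
  apply: (le_trans (uC j)); rewrite powRN invf_le1 ?powR_gt0 ?ltr0n //.
  by rewrite -[leLHS](powRr0 j.+1%:R) ler_powR ?ler1n // invr_ge0 ltW.
have part N : series (rescale C a) N <= S_rho rho.
  have -> : S_rho rho = (2 / rho) / (2 / rho - 1).
    rewrite (_ : 2 / rho - 1 = (2 - rho) / rho); last first.
      by rewrite mulrBl divff ?gt_eqF.
    rewrite /S_rho [((2 - rho) / _)^-1]invfM invrK.
    by rewrite mulrACA mulVf ?gt_eqF // mulr1.
  apply: le_trans (zeta_partial_sum_le _ N _); last first.
    by rewrite ltr_pdivlMr // mul1r.
  apply: ler_sum => j _; rewrite /rescale.
  rewrite (_ : - (2 / rho) = - rho^-1 * 2); last by lra.
  rewrite powRrM powR_mulrn ?powR_ge0 //.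
  by rewrite ler_pXn2r ?nnegrE ?powR_ge0.
have incr : nondecreasing_seq (series (rescale C a)).
  by apply/nondecreasing_series => i _ _; exact: sqr_ge0.
have cv : cvgn (series (rescale C a)).
  by apply: nondecreasing_is_cvgn => //; exists (S_rho rho) => _ [N _ <-].
split; first by move=> j; rewrite u0 u1.
- split => [i j ij|j|//].
    rewrite /rescale ler_pXn2r ?nnegrE //.
    by apply: ler_wpM2r; [rewrite invr_ge0 ltW | exact: ad].
  by rewrite /rescale sqr_ge0 exprn_ile1.
by apply: limr_le => //; exact: nearW.
Qed.

(** |u^2 - v^2| = |u - v| (u + v) and |u - v| <= u + v. *)
Lemma dist_le_powR_quarter {R : realType} (u v Q : R) : 0 <= u -> 0 <= v ->
  `|u ^+ 2 - v ^+ 2| ^+ 2 <= Q -> `|u - v| <= Q `^ (4^-1).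
Proof.
move=> u0 v0 uvQ.
have d4 : `|u - v| ^+ 4 <= Q.
  apply: le_trans uvQ; rewrite (exprM _ 2 2) ler_pXn2r ?nnegrE ?exprn_ge0 //.
  rewrite subr_sqr normrM expr2; apply: ler_wpM2l => //.
  rewrite ler_norml (ger0_norm (addr_ge0 u0 v0)); lra.
have -> : `|u - v| = (`|u - v| ^+ 4) `^ 4^-1.
  by rewrite -powR_mulrn // -powRrM mulfV ?powRr1.
apply: ge0_ler_powR; rewrite ?nnegrE ?exprn_ge0 //.
by apply: le_trans d4; rewrite exprn_ge0.
Qed.

Theorem theorem10p6 (R : realType) :
  (forall (S : R) (x y : R^nat), 0 < S ->
     unit_summable x -> unit_summable y ->
     limn (series x) <= S -> limn (series y) <= S ->
     forall n : nat, (1 <= n)%N ->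
       sup_norm (fun j => x j - y j) ^+ 2
         <= q_dist n x y + 4 * S / Num.sqrt n%:R) /\
  (forall (rho C : R) (a b : R^nat), 0 < rho -> rho < 2 -> 0 < C ->
     decay_class rho C a -> decay_class rho C b ->
     forall n : nat, (1 <= n)%N ->
       sup_norm (fun j => a j - b j) <= C * H_bound rho C n a b).
Proof.
split=> [S x y S0 xs ys xS yS n n1|rho C a b rho0 rho2 C0 aK bK n n1].
  set Q := leRHS; have Q0 : 0 <= Q.
    apply: le_trans (sqr_dist_le_q_dist S x y n 0 n1 xs ys xS yS).
    exact: sqr_ge0.
  have bnd j : `|x j - y j| <= Num.sqrt Q.
    rewrite -(@ler_pXn2r _ 2) ?nnegrE ?sqrtr_ge0 // sqr_sqrtr //.
    exact: (sqr_dist_le_q_dist S x y n j n1 xs ys xS yS).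
  rewrite -(sqr_sqrtr Q0) (@ler_pXn2r _ 2) ?nnegrE ?sqrtr_ge0 //; last first.
    apply: le_trans (normr_ge0 (x 0%N - y 0%N)) _.
    apply: ub_le_sup; last by exists 0%N.
    exists (Num.sqrt Q) => _ [j _ <-]; exact: bnd.
  exact: sup_norm_le.
have [a01 ax aS] := rescale_decay_class _ _ _ rho0 rho2 C0 aK.
have [b01 bx bS] := rescale_decay_class _ _ _ rho0 rho2 C0 bK.
apply: sup_norm_le => j; rewrite -ler_pdivrMl // mulrC.
have -> : `|a j - b j| / C = `|a j / C - b j / C|.
  by rewrite -mulrBl normrM [`|C^-1|]gtr0_norm ?invr_gt0.
have /andP[aj0 aj1] := a01 j; have /andP[bj0 bj1] := b01 j.
rewrite /H_bound le_min; apply/andP; split; first by rewrite ler_norml; lra.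
apply: dist_le_powR_quarter => //.
exact: (sqr_dist_le_q_dist _ _ _ n j n1 ax bx aS bS).
Qed.
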